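(* Let $D_E$ be a $\mathbb{C}$-vector space of finite dimension $m$ and $D_V$ a $\mathbb{C}$-vector space of dimension $2$, and let $\phi$ be an endomorphism of $D_E\otimes D_V$. Then $\phi$ is tree-compatible if and only if there exist bases $\mathcal{B}_E=(e_1,\dots,e_m)$ of $D_E$ and $\mathcal{B}_V=(f_1,f_2)$ of $D_V$ such that the matrix of $\phi$ in the basis $(e_1\otimes f_1,e_1\otimes f_2,\dots,e_m\otimes f_1,e_m\otimes f_2)$ is either the block matrix $J(A,B)=(J(a_{ij},b_{ij}))_{1\leq i,j\leq m}$ or the block matrix $D(A,B)=(D(a_{ij},b_{ij}))_{1\leq i,j\leq m}$, for some $A=(a_{ij}),B=(b_{ij})\in M_m(\mathbb{C})$, where $J(a,b)=\begin{pmatrix}a&b\\0&a\end{pmatrix}$ and $D(a,b)=\begin{pmatrix}a&0\\0&b\end{pmatrix}$.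
   Context: For a linear $\phi$ on $D_E\otimes D_V$, with $\tau$ the flip of $D_E\otimes D_E$, set $\phi_{23}=\mathrm{Id}_{D_E}\otimes\phi$ and $\phi_{13}=(\tau\otimes\mathrm{Id}_{D_V})\circ(\mathrm{Id}_{D_E}\otimes\phi)\circ(\tau\otimes\mathrm{Id}_{D_V})$ on $D_E\otimes D_E\otimes D_V$; $\phi$ is tree-compatible if $\phi_{13}\circ\phi_{23}=\phi_{23}\circ\phi_{13}$. *)

(* Defs.v *)
From mathcomp Require Import all_boot all_order all_algebra.
From HB Require Import structures.
From mathcomp Require Import mxtens.

Set Implicit Arguments.
Unset Strict Implicit.
Unset Printing Implicit Defensive.

Import GRing.Theory.
Local Open Scope ring_scope.

Section Tensor.
Variable K : fieldType.
Implicit Types E U V W X Y : vectType K.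

(* The tensor product of two finite-dimensional spaces, realised as the space *)
(* of matrices of coordinates: [u (x) v] is the matrix of the products of the *)
(* coordinates of [u] and [v] in the reference bases [vbasis fullv].  This    *)
(* choice is immaterial: [tliftE] and [tens_ext] below are the universal      *)
(* property.                                                                  *)
Definition tens U V : vectType K := 'M[K]_(\dim {:U}, \dim {:V}).

Definition tensor U V (u : U) (v : V) : tens U V :=
  \matrix_(i, j) (coord (vbasis {:U}) i u * coord (vbasis {:V}) j v).

(* [tlift b] is the linear map with [tlift b (u (x) v) = b u v] when [b] is   *)
(* bilinear; it is meaningless otherwise.                                     *)
Definition tlift_fun U V W (b : U -> V -> W) (t : tens U V) : W :=
  \sum_i \sum_j t i j *: b (vbasis {:U})`_i (vbasis {:V})`_j.

Definition tlift U V W (b : U -> V -> W) : 'Hom(tens U V, W) :=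
  linfun (tlift_fun b).

Lemma tlift_fun_linear U V W (b : U -> V -> W) : linear (tlift_fun b).
Proof.
move=> a s t; rewrite /tlift_fun scaler_sumr -big_split; apply: eq_bigr => i _.
rewrite scaler_sumr -big_split; apply: eq_bigr => j _.
by rewrite !mxE scalerDl scalerA.
Qed.

Lemma tliftEsum U V W (b : U -> V -> W) (t : tens U V) :
  tlift b t = \sum_i \sum_j t i j *: b (vbasis {:U})`_i (vbasis {:V})`_j.
Proof.
pose F := HB.pack_for {linear tens U V -> W} (tlift_fun b)
  (GRing.isLinear.Build K (tens U V) W _ _ (tlift_fun_linear b)).
exact: (lfunE F t).
Qed.

Lemma tliftE U V W (b : U -> V -> W) :
  (forall v, linear (b^~ v)) -> (forall u, linear (b u)) ->
  forall u v, tlift b (tensor u v) = b u v.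
Proof.
move=> bl br u v; rewrite tliftEsum.
pose BL v := HB.pack_for {linear U -> W} (b^~ v)
  (GRing.isLinear.Build K U W _ _ (bl v)).
pose BR u := HB.pack_for {linear V -> W} (b u)
  (GRing.isLinear.Build K V W _ _ (br u)).
have -> : b u v = \sum_i coord (vbasis {:U}) i u *: b (vbasis {:U})`_i v.
  rewrite -[LHS]/(BL v u) {1}(coord_vbasis (memvf u)) linear_sum.
  by apply: eq_bigr => i _; rewrite linearZ.
apply: eq_bigr => i _; move: (vbasis {:U})`_i => x.
have -> : b x v = \sum_j coord (vbasis {:V}) j v *: b x (vbasis {:V})`_j.
  rewrite -[LHS]/(BR x v) {1}(coord_vbasis (memvf v)) linear_sum.
  by apply: eq_bigr => j _; rewrite linearZ.
by rewrite scaler_sumr; apply: eq_bigr => j _; rewrite mxE scalerA.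
Qed.

Lemma tensor_linearl U V (v : V) : linear (fun u : U => tensor u v).
Proof. by move=> a u u'; apply/matrixP => i j; rewrite !mxE linearP mulrDl mulrA. Qed.

Lemma tensor_linearr U V (u : U) : linear (fun v : V => tensor u v).
Proof.
by move=> a v v'; apply/matrixP => i j; rewrite !mxE linearP mulrDr mulrCA.
Qed.

Lemma tens_sum U V (t : tens U V) :
  t = \sum_i \sum_j t i j *: tensor (vbasis {:U})`_i (vbasis {:V})`_j.
Proof.
rewrite {1}[t]matrix_sum_delta; apply: eq_bigr => i _; apply: eq_bigr => j _.
congr (_ *: _); apply/matrixP => k l; rewrite !mxE.
rewrite !coord_free ?(basis_free (vbasisP _)) //.
by rewrite -natrM mulnb [k == i]eq_sym [l == j]eq_sym.
Qed.

Lemma tens_ext U V W (f g : 'Hom(tens U V, W)) :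
  (forall u v, f (tensor u v) = g (tensor u v)) -> f = g.
Proof.
move=> fg; apply/lfunP => t; rewrite [t]tens_sum !linear_sum /=.
apply: eq_bigr => i _; rewrite !linear_sum /=; apply: eq_bigr => j _.
by rewrite !linearZ; congr (_ *: _); apply: fg.
Qed.

Lemma tlift_linear U V W X (b : X -> U -> V -> W) (t : tens U V) :
  (forall u v, linear (fun x => b x u v)) -> linear (fun x => tlift (b x) t).
Proof.
move=> bl a x y; rewrite !tliftEsum scaler_sumr -big_split; apply: eq_bigr => i _.
rewrite scaler_sumr -big_split; apply: eq_bigr => j _.
by rewrite bl scalerDr !scalerA mulrC.
Qed.

Definition tens_map U V X Y (f : 'Hom(U, X)) (g : 'Hom(V, Y)) :
    'Hom(tens U V, tens X Y) :=
  tlift (fun u v => tensor (f u) (g v)).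

Lemma tens_mapE U V X Y (f : 'Hom(U, X)) (g : 'Hom(V, Y)) u v :
  tens_map f g (tensor u v) = tensor (f u) (g v).
Proof.
rewrite tliftE // => [w|w] a x y; rewrite linearP.
  exact: tensor_linearl.
exact: tensor_linearr.
Qed.

Definition tens_flip U V : 'Hom(tens U V, tens V U) :=
  tlift (fun u v => tensor v u).

Lemma tens_flipE U V (u : U) (v : V) : tens_flip U V (tensor u v) = tensor v u.
Proof.
by rewrite tliftE // => w; [apply: tensor_linearr | apply: tensor_linearl].
Qed.

Definition tens_assoc U V W :
    'Hom(tens (tens U V) W, tens U (tens V W)) :=
  tlift (fun t w => tlift (fun u v => tensor u (tensor v w)) t).

Definition tens_unassoc U V W :
    'Hom(tens U (tens V W), tens (tens U V) W) :=
  tlift (fun u t => tlift (fun v w => tensor (tensor u v) w) t).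

Lemma tens_assocE U V W (u : U) (v : V) (w : W) :
  tens_assoc U V W (tensor (tensor u v) w) = tensor u (tensor v w).
Proof.
rewrite tliftE => [||t]; first (rewrite tliftE // => [x|x] a y z).
- exact: tensor_linearl.
- by rewrite tensor_linearl tensor_linearr.
- by move=> x a y z; rewrite linearP.
- apply: (tlift_linear (b := fun w u v => tensor u (tensor v w))) => x y a z z'.
  by rewrite !tensor_linearr.
Qed.

Lemma tens_unassocE U V W (u : U) (v : V) (w : W) :
  tens_unassoc U V W (tensor u (tensor v w)) = tensor (tensor u v) w.
Proof.
rewrite tliftE => [|t|x a y z]; first (rewrite tliftE // => [x|x] a y z).
- by rewrite tensor_linearr tensor_linearl.
- exact: tensor_linearr.
- apply: (tlift_linear (b := fun u v w => tensor (tensor u v) w)) => x y a z z'.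
  by rewrite !tensor_linearl.
- by rewrite linearP.
Qed.

(* The triple product [E (x) E (x) V] is bracketed as [E (x) (E (x) V)]. *)
Definition phi23 E V (phi : 'End(tens E V)) : 'End(tens E (tens E V)) :=
  tens_map \1%VF phi.

Definition tau12 E V : 'End(tens E (tens E V)) :=
  (tens_assoc E E V \o (tens_map (tens_flip E E) \1 \o tens_unassoc E E V))%VF.

Lemma tau12E E V (x y : E) (v : V) :
  tau12 E V (tensor x (tensor y v)) = tensor y (tensor x v).
Proof.
by rewrite !comp_lfunE tens_unassocE tens_mapE tens_flipE id_lfunE tens_assocE.
Qed.

Definition phi13 E V (phi : 'End(tens E V)) : 'End(tens E (tens E V)) :=
  (tau12 E V \o (phi23 phi \o tau12 E V))%VF.

Definition tree_compatible E V (phi : 'End(tens E V)) : Prop :=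
  (phi13 phi \o phi23 phi)%VF = (phi23 phi \o phi13 phi)%VF.

(* [mxtens_unindex] is the lexicographic bijection from ['I_(m * n)] to       *)
(* ['I_m * 'I_n], so this is e_1 (x) f_1, ..., e_1 (x) f_n, e_2 (x) f_1, ...  *)
Definition tens_basis m n U V (e : m.-tuple U) (f : n.-tuple V) :
    (m * n).-tuple (tens U V) :=
  [tuple tensor (tnth e (mxtens_unindex k).1) (tnth f (mxtens_unindex k).2)
    | k < m * n].

(* Column [l] holds the coordinates of [phi X_l] ([passmx.mxof] is the        *)
(* transpose).                                                                *)
Definition matrix_in n V (X : n.-tuple V) (phi : 'End(V)) : 'M[K]_n :=
  \matrix_(k, l) coord X k (phi X`_l).

Definition blocks m n (F : 'I_m -> 'I_m -> 'M[K]_n) : 'M[K]_(m * n) :=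
  \matrix_(k, l) F (mxtens_unindex k).1 (mxtens_unindex l).1
                   (mxtens_unindex k).2 (mxtens_unindex l).2.

Definition J2 (a b : K) : 'M[K]_2 :=
  block_mx a%:M b%:M
           0    a%:M : 'M[K]_(1 + 1).

Definition D2 (a b : K) : 'M[K]_2 :=
  block_mx a%:M 0
           0    b%:M : 'M[K]_(1 + 1).

Definition Jmx m (A B : 'M[K]_m) : 'M[K]_(m * 2) :=
  blocks (fun i j => J2 (A i j) (B i j)).

Definition Dmx m (A B : 'M[K]_m) : 'M[K]_(m * 2) :=
  blocks (fun i j => D2 (A i j) (B i j)).

End Tensor.

(* Main.v *)
Require Import Defs.
From mathcomp Require Import all_boot all_order all_algebra.
From mathcomp Require Import boolp reals complex.
From HB Require Import structures.
From mathcomp Require Import mxtens ring.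

(* Fix a basis [e] of [D_E] and write [phi (e_j (x) v) = sum_i e_i (x)         *)
(* phi_ij v].  Then [phi_13 phi_23] and [phi_23 phi_13] send                   *)
(* [e_i (x) e_j (x) v] to the sums over [l, k] of [e_l (x) e_k (x) w] with     *)
(* [w = phi_li (phi_kj v)] and [w = phi_kj (phi_li v)] respectively, so        *)
(* tree-compatibility means that the blocks [phi_ij] commute pairwise.  On a   *)
(* plane, either every vector is an eigenvector of every block, or some block  *)
(* [h] has a cyclic vector [v]; in the latter case each block is a polynomial  *)
(* [x + y h], and a basis putting [h] in Jordan form suits all the blocks.     *)

Local Open Scope ring_scope.

Set Implicit Arguments.
Unset Strict Implicit.
Import GRing.Theory.

(** The basis of [DE] is arbitrary: [tree_compatibleP] turns tree-compatibility into pairwise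
    commutation of the blocks for any choice of it. Only the basis of [DV] has to be found, and
    [commuting_J2_or_D2] finds one that suits all blocks at once. Conversely, a matrix of either
    form determines the blocks ([matrix_in_tens_basis], [blocks_inj]). Matrices J(a,b) commute,
    being polynomials in a single nilpotent matrix, and so do diagonal ones; [matrix_in_comm]
    carries this back to endomorphisms. *)

HB.instance Definition _ (K : fieldType) (U V : vectType K) (u : U) :=
  GRing.isLinear.Build K V (tens U V) _ (@tensor K U V u)
    (@tensor_linearr K U V u).

Lemma tensor_suml (K : fieldType) (U V : vectType K) n (F : 'I_n -> U) (v : V) :
  tensor (\sum_i F i) v = \sum_i tensor (F i) v.
Proof.
apply/matrixP => i j; rewrite summxE mxE linear_sum mulr_suml.
by apply: eq_bigr => k _; rewrite mxE.
Qed.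

Lemma tensorZl (K : fieldType) (U V : vectType K) a (u : U) (v : V) :
  tensor (a *: u) v = a *: tensor u v.
Proof. by apply/matrixP => i j; rewrite !mxE linearZ mulrA. Qed.

(** * Matrices of endomorphisms in a basis *)

Section MatrixIn.
Variables (K : fieldType) (V : vectType K) (n : nat) (f : n.-tuple V).
Hypothesis f_basis : basis_of {:V} f.

Lemma matrix_in_comp (g h : 'End(V)) :
  matrix_in f (g \o h)%VF = matrix_in f g *m matrix_in f h.
Proof.
apply/matrixP => k l; rewrite !mxE comp_lfunE.
rewrite {1}(coord_basis f_basis (memvf (h f`_l))) !linear_sum.
by apply: eq_bigr => p _; rewrite !mxE !linearZ mulrC.
Qed.

Lemma matrix_in_inj : injective (@matrix_in K n V f).
Proof.
move=> g h /matrixP gh; apply/lfunP => v.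
rewrite (coord_basis f_basis (memvf v)) !linear_sum /=.
apply: eq_bigr => l _; rewrite !linearZ /=; congr (_ *: _).
rewrite (coord_basis f_basis (memvf (g f`_l))).
rewrite (coord_basis f_basis (memvf (h f`_l))).
by apply: eq_bigr => k _; have := gh k l; rewrite !mxE => ->.
Qed.

Lemma matrix_in_comm (g h : 'End(V)) :
  (g \o h)%VF = (h \o g)%VF <-> comm_mx (matrix_in f g) (matrix_in f h).
Proof.
rewrite /comm_mx -!matrix_in_comp.
by split=> [-> // | /matrix_in_inj].
Qed.

End MatrixIn.

(** * Tensors and endomorphisms in coordinates along the first factor *)

Section Slices.
Variables (K : fieldType) (U V : vectType K) (m n : nat).
Variables (e : m.-tuple U) (f : n.-tuple V).
Hypothesis e_basis : basis_of {:U} e.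

(** Contraction with the i-th vector of the basis dual to [e]. *)
Definition slice i : 'Hom(tens U V, V) := tlift (fun u v => coord e i u *: v).

Lemma sliceE i u v : slice i (tensor u v) = coord e i u *: v.
Proof.
rewrite tliftE // => w a x y; rewrite linearP /=.
  by rewrite scalerDl scalerA.
by [].
Qed.

Lemma slice_sum i (F : 'I_m -> V) :
  slice i (\sum_(j < m) tensor e`_j (F j)) = F i.
Proof.
have slice_basis (j : 'I_m) v : slice i (tensor e`_j v) = (i == j)%:R *: v.
  by rewrite sliceE coord_free ?(basis_free e_basis) // eq_sym.
rewrite linear_sum (bigD1 i) //= slice_basis eqxx scale1r big1 ?addr0 // => j.
by rewrite eq_sym slice_basis => /negPf->; rewrite scale0r.
Qed.

Lemma tens_slice t : t = \sum_(i < m) tensor e`_i (slice i t).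
Proof.
(* With the right side written as a linear map applied to [t], [tens_ext] reduces the claim to pure
   tensors. *)
have -> : \sum_(i < m) tensor e`_i (slice i t) =
    (\sum_(i < m) (linfun (tensor e`_i) \o slice i))%VF t.
  by rewrite sum_lfunE; apply: eq_bigr => i _; rewrite comp_lfunE lfunE.
rewrite -[LHS]id_lfunE; congr (fun_of_lfun _ t); apply: tens_ext => u v.
rewrite id_lfunE sum_lfunE {1}(coord_basis e_basis (memvf u)) tensor_suml.
apply: eq_bigr => i _.
by rewrite comp_lfunE lfunE /= sliceE tensorZl linearZ.
Qed.

Lemma nth_tens_basis (k : 'I_(m * n)) : (tens_basis e f)`_k =
  tensor e`_(mxtens_unindex k).1 f`_(mxtens_unindex k).2.
Proof. by rewrite -tnth_nth tnth_mktuple !(tnth_nth 0). Qed.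

Hypothesis f_basis : basis_of {:V} f.

Lemma tens_basis_expand t :
  t = \sum_(k < m * n) coord f (mxtens_unindex k).2 (slice (mxtens_unindex k).1 t)
        *: (tens_basis e f)`_k.
Proof.
rewrite {1}[t]tens_slice.
rewrite [RHS](reindex (@mxtens_index m n)); last first.
  by exists (@mxtens_unindex m n) => k _; rewrite (mxtens_indexK, mxtens_unindexK).
under [RHS]eq_bigr => p _ do rewrite nth_tens_basis mxtens_indexK.
rewrite -(pair_bigA _ (fun (i : 'I_m) (j : 'I_n) => coord f j (slice i t) *: tensor e`_i f`_j)) /=.
apply: eq_bigr => i _; rewrite {1}(coord_basis f_basis (memvf (slice i t))).
by rewrite linear_sum; apply: eq_bigr => j _; rewrite linearZ.
Qed.

Lemma tens_basisP : basis_of {:tens U V} (tens_basis e f).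
Proof.
rewrite basisEdim; apply/andP; split.
  apply/subvP => t _; rewrite [t]tens_basis_expand.
  by apply: memv_suml => k _; apply/memvZ/memv_span/mem_nth; rewrite size_tuple.
by rewrite size_tuple dimvf /dim /= (size_basis e_basis) (size_basis f_basis).
Qed.

Lemma coord_tens_basis k t : coord (tens_basis e f) k t =
  coord f (mxtens_unindex k).2 (slice (mxtens_unindex k).1 t).
Proof.
by rewrite {1}[t]tens_basis_expand coord_sum_free ?(basis_free tens_basisP).
Qed.

Variable phi : 'End(tens U V).

(** The (i, j) entry of [phi] seen as an m by m matrix over ['End(V)]. *)
Definition tblock (i j : 'I_m) : 'End(V) := linfun (slice i \o phi \o tensor e`_j).

Lemma tblockE i j v : tblock i j v = slice i (phi (tensor e`_j v)).
Proof. by rewrite lfunE. Qed.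

Lemma phi_tensor (j : 'I_m) v : phi (tensor e`_j v) = \sum_(i < m) tensor e`_i (tblock i j v).
Proof.
by rewrite [LHS]tens_slice; apply: eq_bigr => i _; rewrite tblockE.
Qed.

Lemma matrix_in_tens_basis :
  matrix_in (tens_basis e f) phi = blocks (fun i j => matrix_in f (tblock i j)).
Proof.
apply/matrixP => k l.
by rewrite !mxE coord_tens_basis nth_tens_basis tblockE.
Qed.

End Slices.

Lemma blocks_inj (K : fieldType) m n (F G : 'I_m -> 'I_m -> 'M[K]_n) :
  blocks F = blocks G -> F =2 G.
Proof.
move=> /matrixP FG i j; apply/matrixP => p q.
by have := FG (mxtens_index (i, p)) (mxtens_index (j, q)); rewrite !mxE !mxtens_indexK.
Qed.

(** * Tree-compatibility as commutation of the blocks *)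

Section TreeCompatible.
Variables (K : fieldType) (U V : vectType K) (m : nat) (e : m.-tuple U).
Hypothesis e_basis : basis_of {:U} e.
Variable phi : 'End(tens U V).

Lemma phi23_tensor u t : phi23 phi (tensor u t) = tensor u (phi t).
Proof. by rewrite tens_mapE id_lfunE. Qed.

Lemma phi13_tensor (i : 'I_m) u v : phi13 phi (tensor e`_i (tensor u v)) =
  \sum_(l < m) tensor e`_l (tensor u (tblock e phi l i v)).
Proof.
rewrite comp_lfunE [X in tau12 _ _ X]comp_lfunE tau12E phi23_tensor (phi_tensor e_basis phi) !linear_sum /=.
by apply: eq_bigr => l _; rewrite tau12E.
Qed.

Lemma phi13_phi23_tensor (i j : 'I_m) v :
  (phi13 phi \o phi23 phi)%VF (tensor e`_i (tensor e`_j v)) =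
  \sum_(l < m) tensor e`_l (\sum_(k < m)
    tensor e`_k ((tblock e phi l i \o tblock e phi k j)%VF v)).
Proof.
rewrite comp_lfunE phi23_tensor (phi_tensor e_basis phi) !linear_sum /=.
under eq_bigr => k _ do rewrite phi13_tensor.
rewrite exchange_big; apply: eq_bigr => l _; rewrite linear_sum.
by apply: eq_bigr => k _; rewrite comp_lfunE.
Qed.

Lemma phi23_phi13_tensor (i j : 'I_m) v :
  (phi23 phi \o phi13 phi)%VF (tensor e`_i (tensor e`_j v)) =
  \sum_(l < m) tensor e`_l (\sum_(k < m)
    tensor e`_k ((tblock e phi k j \o tblock e phi l i)%VF v)).
Proof.
rewrite comp_lfunE phi13_tensor linear_sum /=.
apply: eq_bigr => l _; rewrite phi23_tensor (phi_tensor e_basis phi).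
by congr (tensor _ _); apply: eq_bigr => k _; rewrite comp_lfunE.
Qed.

Lemma tree_compatibleP : tree_compatible phi <->
  forall i j k l, (tblock e phi i j \o tblock e phi k l)%VF =
                  (tblock e phi k l \o tblock e phi i j)%VF.
Proof.
split=> [tc l i k j | comm].
  apply/lfunP => v.
  have := phi13_phi23_tensor i j v; rewrite tc phi23_phi13_tensor.
  (* Slicing along [l], then along [k], isolates the coefficient of e_l (x) e_k. *)
  move=> /(congr1 (fun t => slice _ e k (slice _ e l t))).
  by rewrite !slice_sum.
apply: tens_ext => u t.
rewrite [t](tens_slice e_basis) linear_sum !linear_sum /=.
apply: eq_bigr => j _; rewrite {1 2}(coord_basis e_basis (memvf u)).
rewrite tensor_suml !linear_sum; apply: eq_bigr => i _.
rewrite tensorZl !linearZ /= phi13_phi23_tensor phi23_phi13_tensor.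
congr (_ *: _); apply: eq_bigr => l _; congr (tensor _ _).
by apply: eq_bigr => k _; rewrite comm.
Qed.

End TreeCompatible.

(** * Endomorphisms of a plane with matrix J(a,b) or D(a,b) *)

Section TwoByTwo.
Variable K : fieldType.

Lemma J2_mul (a b c d : K) : J2 a b *m J2 c d = J2 (a * c) (a * d + b * c).
Proof.
apply: (etrans (@mulmx_block K 1 1 1 1 1 1 _ _ _ _ _ _ _ _)).
by rewrite !mul0mx !mulmx0 !addr0 add0r -!scalar_mxM -raddfD.
Qed.

Lemma D2_mul (a b c d : K) : D2 a b *m D2 c d = D2 (a * c) (b * d).
Proof.
apply: (etrans (@mulmx_block K 1 1 1 1 1 1 _ _ _ _ _ _ _ _)).
by rewrite !mul0mx !mulmx0 !addr0 add0r -!scalar_mxM.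
Qed.

Lemma J2_comm (a b c d : K) : comm_mx (J2 a b) (J2 c d).
Proof. by rewrite /comm_mx !J2_mul; congr J2; ring. Qed.

Lemma D2_comm (a b c d : K) : comm_mx (D2 a b) (D2 c d).
Proof. by rewrite /comm_mx !D2_mul; congr D2; ring. Qed.

Variables (V : vectType K) (f : 2.-tuple V).
Hypothesis f_basis : basis_of {:V} f.

Lemma matrix_in2E (g : 'End(V)) (a b c d : K) :
  g f`_0 = a *: f`_0 + c *: f`_1 -> g f`_1 = b *: f`_0 + d *: f`_1 ->
  matrix_in f g = (block_mx a%:M b%:M c%:M d%:M : 'M[K]_(1 + 1)).
Proof.
(* ['M_2] is convertible to ['M_(1 + 1)], so the matrix splits into four 1 by 1 blocks. *)
move=> g0 g1; rewrite -[LHS](@submxK K 1 1 1 1).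
pose F (x y : K) (i : 'I_2) := if val i == 0%N then x else y.
have FE x y i : coord f i (x *: f`_0 + y *: f`_1) = F x y i.
  rewrite -(coord_sum_free (F x y) i (basis_free f_basis)).
  by rewrite !big_ord_recl big_ord0 addr0.
f_equal; apply/matrixP => i j; rewrite !mxE !ord1 /= ?g0 ?g1 FE /F //=.
Qed.

Lemma J2_matrix_in (g : 'End(V)) (a b : K) :
  g f`_0 = a *: f`_0 -> g f`_1 = b *: f`_0 + a *: f`_1 ->
  matrix_in f g = J2 a b.
Proof.
(* The zero block becomes the scalar matrix of 0, as [matrix_in2E] expects. *)
move=> g0 g1; rewrite /J2 -[0 in RHS](raddf0 (@scalar_mx K 1)).
by apply: matrix_in2E; rewrite // scale0r addr0.
Qed.

Lemma D2_matrix_in (g : 'End(V)) (a b : K) :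
  g f`_0 = a *: f`_0 -> g f`_1 = b *: f`_1 -> matrix_in f g = D2 a b.
Proof.
move=> g0 g1; rewrite /D2 -[0 in RHS](raddf0 (@scalar_mx K 1)).
by apply: matrix_in2E; rewrite // scale0r (addr0, add0r).
Qed.

End TwoByTwo.

(** The index type is arbitrary so that one basis serves the whole family. Algebraic closedness
    enters through the eigenvalues of the cyclic member [h]. *)
Lemma commuting_J2_or_D2 (K : closedFieldType) (V : vectType K) (I : Type)
    (g : I -> 'End(V)) :
  \dim {:V} = 2%N -> (forall i j, (g i \o g j)%VF = (g j \o g i)%VF) ->
  exists (f : 2.-tuple V) (a b : I -> K), basis_of {:V} f /\
    ((forall i, matrix_in f (g i) = J2 (a i) (b i)) \/
     (forall i, matrix_in f (g i) = D2 (a i) (b i))).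
Proof.
move=> dimV comm.
have [[i [v w_v]] | all_eigen] :=
    EM (exists i v, g i v \notin <[v]>%VS); last first.
  have [f f_basis] : exists f : 2.-tuple V, basis_of {:V} f.
    by rewrite -dimV; exists (vbasis {:V}); apply: vbasisP.
  have eigen i v : exists c, g i v = c *: v.
    apply/vlineP; apply/negPn/negP => giv; apply: all_eigen.
    by exists i, v.
  (* Any basis will do here; the eigenvalue of each basis vector is read off as its own
     coordinate. *)
  exists f, (fun i => coord f 0 (g i f`_0)), (fun i => coord f 1 (g i f`_1)).
  split=> //; right=> i; apply: D2_matrix_in => //.
    have [c ->] := eigen i f`_0.
    by rewrite linearZ /= (coord_free 0 0) ?(basis_free f_basis) // mulr1.
  have [c ->] := eigen i f`_1.
  by rewrite linearZ /= (coord_free 1 1) ?(basis_free f_basis) // mulr1.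
set h := g i in w_v; set w := h v in w_v.
have wv_basis : basis_of {:V} [tuple w; v].
  rewrite basisEfree dimV subvf !andbT free_cons span_seq1 w_v seq1_free /=.
  by apply: contraNneq w_v => v0; rewrite /w v0 linear0 mem0v.
have wv_expand z : exists x y, z = x *: v + y *: w.
  have := coord_basis wv_basis (memvf z).
  rewrite !big_ord_recl big_ord0 addr0 /= => ->.
  by eexists; eexists; rewrite addrC.
have basisP x y : v \in <<[:: x; y]>>%VS -> w \in <<[:: x; y]>>%VS ->
    basis_of {:V} [tuple x; y].
  move=> vxy wxy; rewrite basisEdim dimV andbT; apply/subvP => z _.
  by have [c [d ->]] := wv_expand z; rewrite memvD ?memvZ.
(* [x j] and [y j] are the coordinates of [g j v] on [v] and [w]. Both sides commute with [h], so
   agreement at [v] gives agreement at [w = h v], hence everywhere. *)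
have [x [y xyP]] : exists x y : I -> K,
    forall j z, g j z = x j *: z + y j *: h z.
  have [x xP] := choice (fun j => wv_expand (g j v)).
  have [y yP] := choice xP.
  exists x, y => j z; have [c [d ->]] := wv_expand z.
  have gw : g j w = x j *: w + y j *: h w.
    by rewrite /w -comp_lfunE comm comp_lfunE yP linearD !linearZ.
  rewrite !linearD !linearZ /= yP gw !scalerDr !scalerA.
  by rewrite addrACA; congr (_ + _ + (_ + _)); rewrite mulrC.
have [t [s hw]] := wv_expand (h w).
(* [a] and [b] are the eigenvalues of [h]: the roots of [X^2 - s X - t]. *)
have [a a2] := @solve_monicpoly K 2 (fun k => if k is 0%N then t else s) isT.
rewrite !big_ord_recl big_ord0 addr0 expr0 mulr1 expr1 /= in a2.
have [b [abs abt]] : exists b, a + b = s /\ a * b = - t.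
  by exists (s - a); split; [rewrite addrC subrK | ring: a2].
(* This says (h - c)(h - d) v = 0, since h^2 v = s h v + t v. *)
have eigen c d : c + d = s -> c * d = - t ->
    h (w - d *: v) = c *: (w - d *: v).
  move=> cDd cd; rewrite linearB linearZ /= hw -/w scalerBr scalerA cd.
  by rewrite scaleNr opprK -cDd scalerDl addrA addrK addrC.
have ha : h (w - b *: v) = a *: (w - b *: v).
  exact: eigen.
have mem_l (X Y : V) : X \in <<[:: X; Y]>>%VS by rewrite memv_span ?inE ?eqxx.
have mem_r (X Y : V) : Y \in <<[:: X; Y]>>%VS.
  by rewrite memv_span ?inE ?eqxx ?orbT.
have w_mem (X : {vspace V}) : w - b *: v \in X -> v \in X -> w \in X.
  by move=> wX vX; rewrite -[w](subrK (b *: v)) memvD // memvZ.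
(* For a double root, h v = (w - b v) + b v makes [h] a Jordan block, and [x j + y j h] has
   off-diagonal entry [y j]. For distinct roots, two eigenvectors form the basis. *)
have [ab | a_neq_b] := eqVneq a b.
  exists [tuple w - b *: v; v], (fun j => x j + y j * a), y.
  have f_basis : basis_of {:V} [tuple w - b *: v; v].
    by apply: basisP; rewrite ?w_mem.
  split=> //; left=> j; apply: J2_matrix_in => //=; rewrite xyP.
    by rewrite ha scalerA -scalerDl.
  rewrite -/w ab scalerBr scalerA scalerDl [x j *: v + y j * b *: v]addrC.
  by rewrite addrA subrK addrC.
have hb : h (w - a *: v) = b *: (w - a *: v).
  by apply: eigen; [rewrite addrC | rewrite mulrC].
exists [tuple w - b *: v; w - a *: v].
exists (fun j => x j + y j * a), (fun j => x j + y j * b).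
have f_basis : basis_of {:V} [tuple w - b *: v; w - a *: v].
  (* The two eigenvectors differ by (a - b) v, and a - b is invertible. *)
  have v_mem : v \in <<[:: w - b *: v; w - a *: v]>>%VS.
    have dv : (w - b *: v) - (w - a *: v) = (a - b) *: v.
      by rewrite opprB addrC addrA subrK scalerBl.
    rewrite -[v in v \in _]scale1r -(@mulVf _ (a - b)) ?subr_eq0 //.
    by rewrite -scalerA -dv memvZ // memvB.
  by apply: basisP; rewrite ?w_mem.
split=> //; right=> j; apply: D2_matrix_in => //=.
  by rewrite xyP ha scalerA -scalerDl.
by rewrite xyP hb scalerA -scalerDl.
Qed.

Theorem theorem4p14 (R : realType) (m : nat) (DE DV : vectType R[i])
    (dimE : \dim {:DE} = m) (dimV : \dim {:DV} = 2%N)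
    (phi : 'End(tens DE DV)) :
  tree_compatible phi <->
  exists (e : m.-tuple DE) (f : 2.-tuple DV),
    [/\ basis_of {:DE} e, basis_of {:DV} f &
        exists A B : 'M[R[i]]_m,
          matrix_in (tens_basis e f) phi = Jmx A B \/
          matrix_in (tens_basis e f) phi = Dmx A B].
Proof.
split=> [tc | [e [f [e_basis f_basis [A [B JD]]]]]].
  have [e e_basis] : exists e : m.-tuple DE, basis_of {:DE} e.
    by rewrite -dimE; exists (vbasis {:DE}); apply: vbasisP.
  have comm := (tree_compatibleP e_basis phi).1 tc.
  (* The family is indexed by pairs (i, j), so [f] and the choice between J and D are common to all
     blocks. *)
  have [f [a [b [f_basis ab]]]] := commuting_J2_or_D2
    (g := fun ij => tblock e phi ij.1 ij.2) dimV (fun ij kl => comm _ _ _ _).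
  exists e, f; split=> //.
  exists (\matrix_(i, j) a (i, j)), (\matrix_(i, j) b (i, j)).
  rewrite matrix_in_tens_basis //.
  case: ab => ab; [left | right]; apply/matrixP => k l; rewrite [LHS]mxE
    [RHS]mxE (ab (_, _)); by rewrite !mxE.
apply/(tree_compatibleP e_basis) => i j k l.
apply/(matrix_in_comm f_basis).
by case: JD; rewrite matrix_in_tens_basis // => /blocks_inj JD;
  rewrite !JD; [apply: J2_comm | apply: D2_comm].
Qed.
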